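(* Let $G$ be a finite group acting on a regular Hom-pre-Lie algebra $(A,\cdot,\alpha)$ over a field $\mathbb{K}$ of characteristic zero, and let $(\mathfrak{v}_t,\mathfrak{a}_t)=\{(\nu^H_t,\alpha^H_t)\}_{H\le G}$ be an equivariant deformation of order $n$ of $A$. Then $(\mathfrak{v}_t,\mathfrak{a}_t)$ is extendable to an equivariant deformation of order $n+1$ if and only if the (equivariant) cohomology class of the equivariant obstruction $O^n_G(A)$ vanishes.
   Context: A Hom-pre-Lie algebra $(A,\cdot,\alpha)$ is a $\mathbb{K}$-vector space $A$ with a bilinear product $\cdot$ and a linear map $\alpha:A\to A$ such that for all $a,b,c\in A$: $(a\cdot b)\cdot\alpha(c)-\alpha(a)\cdot(b\cdot c)=(b\cdot a)\cdot\alpha(c)-\alpha(b)\cdot(a\cdot c)$ and $\alpha(a\cdot b)=\alpha(a)\cdot\alpha(b)$; it is regular if $\alpha$ is invertible (standing assumption). A finite group $G$ acts on $A$ if there is a map $G\times A\to A$, $(g,a)\mapsto ga=\psi_g(a)$, with each $\psi_g$ linear, $ea=a$, $(g_1g_2)a=g_1(g_2a)$, $g(a\cdot b)=ga\cdot gb$ and $\alpha(ga)=g\alpha(a)$. For $H\le G$, $A^H=\{a\in A\mid ha=a\ \forall h\in H\}$ is a sub Hom-pre-Lie algebra. If $g^{-1}Hg\subseteq K$ (with $g\in G$, $H,K\le G$), then $\psi_g$ restricts to a map $A^K\to A^H$. An equivariant deformation of order $n$ of $A$ is a family $\{(\nu^H_t,\alpha^H_t)\}_{H\le G}$, $\nu^H_t=\sum_{i=0}^n\nu^H_it^i$,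 $\alpha^H_t=\sum_{i=0}^n\alpha^H_it^i$, with $\nu^H_i:A^H\times A^H\to A^H$ $\mathbb{K}$-bilinear and $\alpha^H_i:A^H\to A^H$ $\mathbb{K}$-linear (extended $\mathbb{K}[[t]]$-linearly), such that for all $H\le G$, $a,b,c\in A^H$: $\nu^H_0(a,b)=a\cdot b$, $\alpha^H_0(a)=\alpha(a)$, and modulo $t^{n+1}$: (i) $\nu^H_t(\nu^H_t(a,b),\alpha^H_t(c))-\nu^H_t(\alpha^H_t(a),\nu^H_t(b,c))=\nu^H_t(\nu^H_t(b,a),\alpha^H_t(c))-\nu^H_t(\alpha^H_t(b),\nu^H_t(a,c))$; (ii) $\nu^H_t(\alpha^H_t(a),\alpha^H_t(b))=\alpha^H_t(\nu^H_t(a,b))$; (iii) whenever $g^{-1}Hg\subseteq K$, $\nu^H_t\circ(\psi_g\otimes\psi_g)=\psi_g\circ\nu^K_t$ and $\alpha^H_t\circ\psi_g=\psi_g\circ\alpha^K_t$ on $A^K$. It is extendable to order $n+1$ if for all $H\le G$ there are a bilinear $\nu^H_{n+1}$ and a linear $\alpha^H_{n+1}$ on $A^H$ such that the family $(\nu^H_t+\nu^H_{n+1}t^{n+1},\alpha^H_t+\alpha^H_{n+1}t^{n+1})$ satisfies (i)-(iii) modulo $t^{n+2}$. For bilinear $\nu_i,\nu_j$ and linear $\alpha_k$: $(\nu_i\circ_{\alpha_k}\nu_j)(a,b,c)=\nu_i(\nu_j(a,b),\alpha_k(c))-\nu_i(\alpha_k(a),\nu_j(b,c))$. The obstruction is $O^n_G(A)=(\oplus_{H\le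 G}O^{n,H}_\nu(A),\oplus_{H\le G}O^{n,H}_\alpha(A))$ where, for $a,b,c\in A^H$, $$O^{n,H}_\nu(A)(a,b,c)=\sum_{\substack{i+j+k=n+1\\0\le i,j,k\le n}}(\nu^H_i\circ_{\alpha^H_k}\nu^H_j)(a,b,c)-\sum_{\substack{i+j+k=n+1\\0\le i,j,k\le n}}(\nu^H_i\circ_{\alpha^H_k}\nu^H_j)(b,a,c),$$ $$O^{n,H}_\alpha(A)(a,b)=\sum_{\substack{i+j+k=n+1\\0\le i,j,k\le n}}\nu^H_i(\alpha^H_j(a),\alpha^H_k(b))-\sum_{\substack{i+j=n+1\\0\le i,j\le n}}\alpha^H_i(\nu^H_j(a,b)).$$ Equivariant cochains: for a Hom-pre-Lie algebra $B$, $\widetilde C^2(B,B)=\mathrm{Hom}(B^{\otimes2},B)\oplus\mathrm{Hom}(B,B)$, $\widetilde C^3(B,B)=\mathrm{Hom}(B^{\otimes3},B)\oplus\mathrm{Hom}(B^{\otimes2},B)$, and $\widetilde\partial(\varphi,\psi)=(\widetilde\partial_{\nu\nu}\varphi-\widetilde\partial_{\alpha\nu}\psi,\ \widetilde\partial_{\nu\alpha}\varphi-\widetilde\partial_{\alpha\alpha}\psi)$ with $(\widetilde\partial_{\nu\nu}\varphi)(a,b,c)=\alpha(a)\cdot\varphi(b,c)-\alpha(b)\cdot\varphi(a,c)+\varphi(b,a)\cdot\alpha(c)-\varphi(a,b)\cdot\alpha(c)-\varphi(\alpha(b),a\cdot c)+\varphi(\alpha(a),b\cdot c)-\varphi(a\cdot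 b,\alpha(c))+\varphi(b\cdot a,\alpha(c))$; $(\widetilde\partial_{\alpha\nu}\psi)(a,b,c)=\psi(b)\cdot(a\cdot c)-\psi(a)\cdot(b\cdot c)+(a\cdot b)\cdot\psi(c)-(b\cdot a)\cdot\psi(c)$; $(\widetilde\partial_{\nu\alpha}\varphi)(a,b)=\alpha(\varphi(a,b))-\varphi(\alpha(a),\alpha(b))$; $(\widetilde\partial_{\alpha\alpha}\psi)(a,b)=\alpha(a)\cdot\psi(b)+\psi(a)\cdot\alpha(b)-\psi(a\cdot b)$. $S^m_G$ is the space of families $c=\{(c^H_\nu,c^H_\alpha)\}_{H\le G}\in\bigoplus_{H\le G}\widetilde C^m(A^H,A^H)$ that are invariant: whenever $g^{-1}Hg\subseteq K$, $c^H_\nu\circ\psi_g^{\otimes m}=\psi_g\circ c^K_\nu$ and $c^H_\alpha\circ\psi_g^{\otimes(m-1)}=\psi_g\circ c^K_\alpha$ on tensor powers of $A^K$. $\delta:S^2_G\to S^3_G$ applies $\widetilde\partial$ of $A^H$ in each component $H$. ''The cohomology class of $O^n_G(A)$ vanishes'' means $O^n_G(A)=\delta(c)$ for some invariant $2$-cochain $c\in S^2_G$. *)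

(* Defs.v *)
From HB Require Import structures.
From mathcomp Require Import all_boot all_order all_algebra all_fingroup.

Set Implicit Arguments.
Unset Strict Implicit.
Unset Printing Implicit Defensive.

Import GRing.Theory.
Local Open Scope ring_scope.

HB.mixin Record Lmodule_isHomPreLie (K : fieldType) A of GRing.Lmodule K A := {
  hmul : {bilinear A -> A -> A};
  twist : {linear A -> A};
  hom_pre_lieP : forall a b c : A,
    hmul (hmul a b) (twist c) - hmul (twist a) (hmul b c) =
    hmul (hmul b a) (twist c) - hmul (twist b) (hmul a c);
  twistM : forall a b : A, twist (hmul a b) = hmul (twist a) (twist b)
}.

#[short(type="homPreLieType")]
HB.structure Definition HomPreLie (K : fieldType) :=
  {A of Lmodule_isHomPreLie K A & GRing.Lmodule K A}.

Definition regular (K : fieldType) (A : homPreLieType K) :=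
  bijective (twist : A -> A).

(* A left action; MathComp's own [action] is a right action. *)
Record hpl_action (gT : finGroupType) (K : fieldType) (A : homPreLieType K) :=
  HplAction {
    hact :> gT -> {linear A -> A};
    hact1 : forall a, hact 1%g a = a;
    hactM : forall g1 g2 a, hact (g1 * g2)%g a = hact g1 (hact g2 a);
    hact_mul : forall g a b, hact g (hmul a b) = hmul (hact g a) (hact g b);
    hact_twist : forall g a, twist (hact g a) = hact g (twist a)
  }.

Section Fixed.

Variables (gT : finGroupType) (K : fieldType) (A : homPreLieType K).
Variables (psi : hpl_action gT A) (H : {group gT}).

Definition fixpred : {pred A} := fun a => [forall h in H, psi h a == a].

Lemma fixP a : reflect {in H, forall h, psi h a = a} (a \in fixpred).
Proof. exact: 'forall_in_eqP. Qed.

Lemma fixpred_submod : submod_closed fixpred.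
Proof.
split=> [|k x y /fixP xP /fixP yP]; apply/fixP => h hH; rewrite ?linear0 //.
by rewrite linearP xP ?yP.
Qed.

HB.instance Definition _ :=
  GRing.isSubmodClosed.Build K A fixpred fixpred_submod.

Inductive fixed : predArgType := Fixed a of a \in fixpred.
Definition fixval u := let: Fixed a _ := u in a.

HB.instance Definition _ := [isSub of fixed for fixval].
HB.instance Definition _ := [Choice of fixed by <:].
HB.instance Definition _ := [SubChoice_isSubZmodule of fixed by <:].
HB.instance Definition _ := [SubZmodule_isSubLmodule of fixed by <:].

Lemma fixval_in (u : fixed) : fixval u \in fixpred.
Proof. by case: u. Qed.

Lemma fixed_mul_subproof (u v : fixed) : hmul (fixval u) (fixval v) \in fixpred.
Proof.
have [/fixP uP /fixP vP] := (fixval_in u, fixval_in v).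
by apply/fixP => h hH; rewrite hact_mul uP ?vP.
Qed.

Lemma fixed_twist_subproof (u : fixed) : twist (fixval u) \in fixpred.
Proof.
have /fixP uP := fixval_in u.
by apply/fixP => h hH; rewrite -hact_twist uP.
Qed.

Definition fixed_mul u v : fixed := Fixed (fixed_mul_subproof u v).
Definition fixed_twist u : fixed := Fixed (fixed_twist_subproof u).

Lemma fixed_mul_bilinear : bilinear_for *:%R *:%R fixed_mul.
Proof.
split=> [w|w] k u v; apply: val_inj => /=; first exact: linearPl.
exact: linearPr.
Qed.

Lemma fixed_twist_linear : linear fixed_twist.
Proof. by move=> k u v; apply: val_inj; apply: linearP. Qed.

HB.instance Definition _ :=
  bilinear_isBilinear.Build K fixed fixed fixed *:%R *:%R fixed_mul
    fixed_mul_bilinear.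
HB.instance Definition _ :=
  GRing.isLinear.Build K fixed fixed *:%R fixed_twist fixed_twist_linear.

Lemma fixed_hom_pre_lie (a b c : fixed) :
  fixed_mul (fixed_mul a b) (fixed_twist c) -
    fixed_mul (fixed_twist a) (fixed_mul b c) =
  fixed_mul (fixed_mul b a) (fixed_twist c) -
    fixed_mul (fixed_twist b) (fixed_mul a c).
Proof. by apply: val_inj; apply: hom_pre_lieP. Qed.

Lemma fixed_twistM (a b : fixed) :
  fixed_twist (fixed_mul a b) = fixed_mul (fixed_twist a) (fixed_twist b).
Proof. by apply: val_inj; apply: twistM. Qed.

HB.instance Definition _ :=
  Lmodule_isHomPreLie.Build K fixed fixed_hom_pre_lie fixed_twistM.

End Fixed.

Section Restriction.

Variables (gT : finGroupType) (K : fieldType) (A : homPreLieType K).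
Variables (psi : hpl_action gT A) (H J : {group gT}) (g : gT).

(* In MathComp [H :^ g] is [g^-1 * H * g]. *)
Hypothesis sHJ : (H :^ g \subset J)%g.

Lemma restr_subproof (u : fixed psi J) : psi g (fixval u) \in fixpred psi H.
Proof.
have /fixP uP := fixval_in u; apply/fixP => h hH.
rewrite -hactM (_ : (h * g = g * h ^ g)%g); last by rewrite -conjgC.
by rewrite hactM uP // (subsetP sHJ) // memJ_conjg.
Qed.

Definition restr (u : fixed psi J) : fixed psi H := Fixed (restr_subproof u).

Lemma restr_linear : linear restr.
Proof. by move=> k u v; apply: val_inj; apply: linearP. Qed.

HB.instance Definition _ :=
  GRing.isLinear.Build K (fixed psi J) (fixed psi H) *:%R restr restr_linear.

End Restriction.

Arguments restr {gT K A} psi {H J g} sHJ u.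

Section Cochains.

Variables (K : fieldType) (B : homPreLieType K).
Implicit Types (a b c : B).

Definition trilinear (f : B -> B -> B -> B) :=
  [/\ forall b c, linear (fun a => f a b c),
      forall a c, linear (fun b => f a b c) &
      forall a b, linear (f a b)].

Record cochain2 := Cochain2 {
  c2nu : {bilinear B -> B -> B};
  c2al : {linear B -> B}
}.

Record cochain3 := Cochain3 {
  c3nu : B -> B -> B -> B;
  c3al : B -> B -> B;
  c3nuP : trilinear c3nu;
  c3alP : bilinear_for *:%R *:%R c3al
}.

Definition cochain3_eq (x y : cochain3) : Prop :=
  (forall a b c, c3nu x a b c = c3nu y a b c) /\
  (forall a b, c3al x a b = c3al y a b).

Definition d_nunu (phi : B -> B -> B) a b c : B :=
  hmul (twist a) (phi b c) - hmul (twist b) (phi a c)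
  + hmul (phi b a) (twist c) - hmul (phi a b) (twist c)
  - phi (twist b) (hmul a c) + phi (twist a) (hmul b c)
  - phi (hmul a b) (twist c) + phi (hmul b a) (twist c).

Definition d_alnu (psi : B -> B) a b c : B :=
  hmul (psi b) (hmul a c) - hmul (psi a) (hmul b c)
  + hmul (hmul a b) (psi c) - hmul (hmul b a) (psi c).

Definition d_nual (phi : B -> B -> B) a b : B :=
  twist (phi a b) - phi (twist a) (twist b).

Definition d_alal (psi : B -> B) a b : B :=
  hmul (twist a) (psi b) + hmul (psi a) (twist b) - psi (hmul a b).

Definition circ (nu_i : B -> B -> B) (al_k : B -> B) (nu_j : B -> B -> B)
    a b c : B :=
  nu_i (nu_j a b) (al_k c) - nu_i (al_k a) (nu_j b c).

Lemma trilinear_eq f f' :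
  (forall a b c, f a b c = f' a b c) -> trilinear f -> trilinear f'.
Proof.
by move=> e [f1 f2 f3]; split=> x y k u v; rewrite -!e ?f1 ?f2 ?f3.
Qed.

Lemma trilinearD f f' : trilinear f -> trilinear f' ->
  trilinear (fun a b c => f a b c + f' a b c).
Proof.
move=> [f1 f2 f3] [g1 g2 g3].
by split=> x y k u v; rewrite (f1, f2, f3) (g1, g2, g3) scalerDr addrACA.
Qed.

Lemma trilinearN f : trilinear f -> trilinear (fun a b c => - f a b c).
Proof.
move=> [f1 f2 f3].
by split=> x y k u v; rewrite (f1, f2, f3) opprD scalerN.
Qed.

Lemma trilinearC f : trilinear f -> trilinear (fun a b c => f b a c).
Proof. by move=> [f1 f2 f3]; split=> x y; [apply: f2|apply: f1|apply: f3]. Qed.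

Lemma trilinear0 : trilinear (fun _ _ _ => 0).
Proof. by split=> x y k u v; rewrite scaler0 addr0. Qed.

Lemma trilinear_sum I (r : seq I) (P : pred I) (F : I -> B -> B -> B -> B) :
  (forall i, trilinear (F i)) ->
  trilinear (fun a b c => \sum_(i <- r | P i) F i a b c).
Proof.
move=> FP; elim: r => [|i r IHr].
  by apply: trilinear_eq trilinear0 => a b c; rewrite big_nil.
case Pi: (P i); last first.
  by apply: trilinear_eq IHr => a b c; rewrite big_cons Pi.
by apply: trilinear_eq (trilinearD (FP i) IHr) => a b c; rewrite big_cons Pi.
Qed.

Lemma bilinearD (f f' : B -> B -> B) : bilinear_for *:%R *:%R f ->
  bilinear_for *:%R *:%R f' -> bilinear_for *:%R *:%R (fun a b => f a b + f' a b).
Proof.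
move=> [f1 f2] [g1 g2].
split=> x k u v.
  by rewrite (f1 x k) (g1 x k) /= scalerDr addrACA.
by rewrite (f2 x k) (g2 x k) /= scalerDr addrACA.
Qed.

Lemma bilinearN (f : B -> B -> B) : bilinear_for *:%R *:%R f ->
  bilinear_for *:%R *:%R (fun a b => - f a b).
Proof.
move=> [f1 f2]; split=> x k u v; first by rewrite (f1 x k) /= opprD scalerN.
by rewrite (f2 x k) /= opprD scalerN.
Qed.

Lemma bilinear_sum I (r : seq I) (P : pred I) (F : I -> B -> B -> B) :
  (forall i, bilinear_for *:%R *:%R (F i)) ->
  bilinear_for *:%R *:%R (fun a b => \sum_(i <- r | P i) F i a b).
Proof.
move=> FP; elim: r => [|i r [f1 f2]].
  by split=> x k u v; rewrite !big_nil /= scaler0 addr0.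
have [g1 g2] := FP i; split=> x k u v; rewrite !big_cons; case: (P i).
- by rewrite (f1 x k) (g1 x k) /= scalerDr addrACA.
- by rewrite (f1 x k).
- by rewrite (f2 x k) (g2 x k) /= scalerDr addrACA.
- by rewrite (f2 x k).
Qed.

Section Multilinearity.

Variables (f f' : {bilinear B -> B -> B}) (l l' : {linear B -> B}).

Lemma trilinear_l : trilinear (fun a b c => f (f' a b) (l c)).
Proof.
by split=> x y k u v; rewrite ?linearP ?linearPl ?linearPr ?linearPl.
Qed.

Lemma trilinear_r : trilinear (fun a b c => f (l a) (f' b c)).
Proof.
by split=> x y k u v; rewrite ?linearP ?linearPl ?linearPr ?linearPl.
Qed.

Lemma bilinear_2l : bilinear_for *:%R *:%R (fun a b => f (l a) (l' b)).
Proof. by split=> x k u v; rewrite linearP ?linearPl ?linearPr. Qed.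

Lemma bilinear_l2 : bilinear_for *:%R *:%R (fun a b => l (f a b)).
Proof. by split=> x k u v; rewrite ?linearPl ?linearPr linearP. Qed.

Lemma circ_trilinear : trilinear (circ f l f').
Proof. exact: trilinearD trilinear_l (trilinearN trilinear_r). Qed.

End Multilinearity.

Section Coboundary.

Variable x : cochain2.

Lemma d_nu_trilinear :
  trilinear (fun a b c => d_nunu (c2nu x) a b c - d_alnu (c2al x) a b c).
Proof.
case: x => phi ps /=.
apply: trilinearD; last apply: trilinearN;
  repeat (apply: trilinearD || apply: trilinearN);
  first [exact: trilinear_l | exact: trilinear_r
        | exact: (trilinearC (trilinear_l _ _ _))
        | exact: (trilinearC (trilinear_r _ _ _))].
Qed.

Lemma d_al_bilinear : bilinear_for *:%R *:%R
  (fun a b => d_nual (c2nu x) a b - d_alal (c2al x) a b).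
Proof.
case: x => phi ps /=.
apply: bilinearD; last apply: bilinearN;
  repeat (apply: bilinearD || apply: bilinearN);
  first [exact: bilinear_l2 | exact: bilinear_2l
        | exact: (bilinear_2l _ idfun)].
Qed.

Definition coboundary : cochain3 := Cochain3 d_nu_trilinear d_al_bilinear.

End Coboundary.

End Cochains.

(* A power series in V[[t]] is its sequence of coefficients, and [subS] is
   subtraction in V[[t]]. *)
Section Series.

Variables (K : fieldType) (V : lmodType K).
Implicit Types (f g : nat -> V).

Definition constS (a : V) : nat -> V := fun m => if m is 0 then a else 0.

Definition subS f g : nat -> V := fun m => f m - g m.

Definition eqS_mod (N : nat) f g : Prop := forall m, (m < N)%N -> f m = g m.

(* The K[[t]]-(bi)linear extensions to V[[t]] of
   [\sum_(i <= n) al_i t^i] and [\sum_(i <= n) nu_i t^i]. *)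
Definition linS n (al : 'I_n.+1 -> {linear V -> V}) f : nat -> V := fun m =>
  \sum_(i < n.+1) \sum_(j < m.+1 | (i + j == m)%N) al i (f j).

Definition bilS n (nu : 'I_n.+1 -> {bilinear V -> V -> V}) f g : nat -> V :=
  fun m => \sum_(i < n.+1) \sum_(j < m.+1) \sum_(k < m.+1 | (i + j + k == m)%N)
    nu i (f j) (g k).

Lemma linS_const n (al : 'I_n.+1 -> {linear V -> V}) a (i : 'I_n.+1) :
  linS al (constS a) i = al i a.
Proof.
rewrite /linS (bigD1 i) //= (bigD1 ord0) /= ?addn0 //.
rewrite [X in _ + X + _]big1 => [|[[|k] hk] /andP[_ //] _]; last first.
  by rewrite linear0.
rewrite addr0 big1 ?addr0 // => j neq_ji.
apply: big1 => -[[|k] hk] /=; last by rewrite linear0.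
by rewrite addn0 val_eqE (negPf neq_ji).
Qed.

Lemma bilS_const n (nu : 'I_n.+1 -> {bilinear V -> V -> V}) a b (i : 'I_n.+1) :
  bilS nu (constS a) (constS b) i = nu i a b.
Proof.
rewrite /bilS (bigD1 i) //= (bigD1 ord0) //= (bigD1 ord0) /= ?addn0 //.
rewrite [X in _ + X + _ + _]big1 => [|[[|k] hk] /andP[_ //] _]; last first.
  by rewrite linear0r.
rewrite [X in _ + X + _]big1 => [|[[|k] hk] // _]; last first.
  by apply: big1 => l _; rewrite linear0l.
rewrite !addr0 big1 ?addr0 // => j neq_ji.
apply: big1 => -[[|k] hk] _ /=; apply: big1 => l; last by rewrite linear0l.
case: l => [[|l] hl] /=; last by rewrite linear0r.
by rewrite !addn0 val_eqE (negPf neq_ji).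
Qed.

End Series.

Section Equivariant.

Variables (gT : finGroupType) (K : fieldType) (A : homPreLieType K).
Variable psi : hpl_action gT A.

Definition nu_family n := forall H : {group gT},
  'I_n.+1 -> {bilinear fixed psi H -> fixed psi H -> fixed psi H}.

Definition al_family n := forall H : {group gT},
  'I_n.+1 -> {linear fixed psi H -> fixed psi H}.

Record equivariant_deformation n (nu : nu_family n) (al : al_family n) : Prop :=
  EquivariantDeformation {
    edef_nu0 : forall H a b, nu H ord0 a b = hmul a b;
    edef_al0 : forall H a, al H ord0 a = twist a;
    edef_hom_pre_lie : forall H (a b c : fixed psi H),
      let nut := bilS (nu H) in
      let alt := linS (al H) in
      let a' := constS a in let b' := constS b in let c' := constS c in
      eqS_mod n.+1
        (subS (nut (nut a' b') (alt c')) (nut (alt a') (nut b' c')))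
        (subS (nut (nut b' a') (alt c')) (nut (alt b') (nut a' c')));
    edef_mult : forall H (a b : fixed psi H),
      let nut := bilS (nu H) in
      let alt := linS (al H) in
      eqS_mod n.+1
        (nut (alt (constS a)) (alt (constS b)))
        (alt (nut (constS a) (constS b)));
    edef_nu_equiv : forall (H J : {group gT}) (g : gT)
        (sHJ : (H :^ g \subset J)%g) (a b : fixed psi J),
      eqS_mod n.+1
        (bilS (nu H) (constS (restr psi sHJ a)) (constS (restr psi sHJ b)))
        (restr psi sHJ \o bilS (nu J) (constS a) (constS b));
    edef_al_equiv : forall (H J : {group gT}) (g : gT)
        (sHJ : (H :^ g \subset J)%g) (a : fixed psi J),
      eqS_mod n.+1
        (linS (al H) (constS (restr psi sHJ a)))
        (restr psi sHJ \o linS (al J) (constS a))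
  }.

Definition add_coef T n (f : 'I_n.+1 -> T) (x : T) : 'I_n.+2 -> T :=
  fun i => if unlift ord_max i is Some j then f j else x.

Definition extendable n (nu : nu_family n) (al : al_family n) : Prop :=
  exists (nu' : forall H, {bilinear fixed psi H -> fixed psi H -> fixed psi H})
         (al' : forall H, {linear fixed psi H -> fixed psi H}),
    equivariant_deformation (n := n.+1)
      (fun H => add_coef (nu H) (nu' H)) (fun H => add_coef (al H) (al' H)).

Definition cochain2_family := forall H : {group gT}, cochain2 (fixed psi H).
Definition cochain3_family := forall H : {group gT}, cochain3 (fixed psi H).

Definition invariant2 (x : cochain2_family) : Prop :=
  forall (H J : {group gT}) (g : gT) (sHJ : (H :^ g \subset J)%g),
    let r := restr psi sHJ in
    (forall a b, c2nu (x H) (r a) (r b) = r (c2nu (x J) a b)) /\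
    (forall a, c2al (x H) (r a) = r (c2al (x J) a)).

Definition invariant3 (x : cochain3_family) : Prop :=
  forall (H J : {group gT}) (g : gT) (sHJ : (H :^ g \subset J)%g),
    let r := restr psi sHJ in
    (forall a b c, c3nu (x H) (r a) (r b) (r c) = r (c3nu (x J) a b c)) /\
    (forall a b, c3al (x H) (r a) (r b) = r (c3al (x J) a b)).

Definition delta (x : cochain2_family) : cochain3_family :=
  fun H => coboundary (x H).

Section Obstruction.

Variables (n : nat) (nu : nu_family n) (al : al_family n).

Definition obs_nu H (a b c : fixed psi H) : fixed psi H :=
  \sum_(i < n.+1) \sum_(j < n.+1) \sum_(k < n.+1 | (i + j + k == n.+1)%N)
    circ (nu H i) (al H k) (nu H j) a b c
  - \sum_(i < n.+1) \sum_(j < n.+1) \sum_(k < n.+1 | (i + j + k == n.+1)%N)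
    circ (nu H i) (al H k) (nu H j) b a c.

Definition obs_al H (a b : fixed psi H) : fixed psi H :=
  \sum_(i < n.+1) \sum_(j < n.+1) \sum_(k < n.+1 | (i + j + k == n.+1)%N)
    nu H i (al H j a) (al H k b)
  - \sum_(i < n.+1) \sum_(j < n.+1 | (i + j == n.+1)%N) al H i (nu H j a b).

Lemma obs_nu_trilinear H : trilinear (@obs_nu H).
Proof.
have sumP : trilinear (fun a b c : fixed psi H =>
    \sum_(i < n.+1) \sum_(j < n.+1) \sum_(k < n.+1 | (i + j + k == n.+1)%N)
      circ (nu H i) (al H k) (nu H j) a b c).
  do 3!apply: trilinear_sum => ?; exact: circ_trilinear.
exact: trilinearD sumP (trilinearN (trilinearC sumP)).
Qed.

Lemma obs_al_bilinear H : bilinear_for *:%R *:%R (@obs_al H).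
Proof.
apply: bilinearD; last apply: bilinearN.
  do 3!apply: bilinear_sum => ?; exact: bilinear_2l.
do 2!apply: bilinear_sum => ?; exact: bilinear_l2.
Qed.

Definition obstruction : cochain3_family :=
  fun H => Cochain3 (obs_nu_trilinear H) (obs_al_bilinear H).

Definition obstruction_class_vanishes : Prop :=
  exists2 x : cochain2_family,
    invariant2 x & forall H, cochain3_eq (obstruction H) (delta x H).

End Obstruction.

Lemma restr_mul (H J : {group gT}) (g : gT)
    (sHJ : (H :^ g \subset J)%g) (a b : fixed psi J) :
  restr psi sHJ (hmul a b) = hmul (restr psi sHJ a) (restr psi sHJ b).
Proof. by apply: val_inj; apply: hact_mul. Qed.

Lemma restr_twist (H J : {group gT}) (g : gT)
    (sHJ : (H :^ g \subset J)%g) (a : fixed psi J) :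
  restr psi sHJ (twist a) = twist (restr psi sHJ a).
Proof. by apply: val_inj; rewrite /= hact_twist. Qed.

Lemma restrD (H J : {group gT}) (g : gT)
    (sHJ : (H :^ g \subset J)%g) : {morph restr psi sHJ : a b / a + b}.
Proof. by move=> a b; rewrite linearD. Qed.

Lemma restrB (H J : {group gT}) (g : gT)
    (sHJ : (H :^ g \subset J)%g) : {morph restr psi sHJ : a b / a - b}.
Proof. by move=> a b; rewrite linearB. Qed.

Lemma invariant_delta x : invariant2 x -> invariant3 (delta x).
Proof.
move=> xP H J g sHJ; have [nuP alP] := xP H J g sHJ; move: nuP alP => /=.
rewrite /delta /= /d_nunu /d_alnu /d_nual /d_alal => nuP alP.
by split=> [a b c|a b];
  rewrite !(=^~ restr_twist, nuP, alP, =^~ restr_mul) -!(restrB, restrD).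
Qed.

Lemma invariant_obstruction n (nu : nu_family n) (al : al_family n) :
  equivariant_deformation nu al -> invariant3 (obstruction nu al).
Proof.
case=> _ _ _ _ nuP alP H J g sHJ r.
have nuE i a b : nu H i (r a) (r b) = r (nu J i a b).
  by have := nuP H J g sHJ a b i (ltn_ord i); rewrite /= !bilS_const.
have alE i a : al H i (r a) = r (al J i a).
  by have := alP H J g sHJ a i (ltn_ord i); rewrite /= !linS_const.
have sumE I (s : seq I) (P : pred I) (F : I -> fixed psi J) :
    r (\sum_(i <- s | P i) F i) = \sum_(i <- s | P i) r (F i).
  exact: linear_sum.
split=> [a b c|a b] /=; rewrite /obs_nu /obs_al /circ /r restrB -/r !sumE.
  congr (_ - _); apply: eq_bigr => i _; rewrite sumE; apply: eq_bigr => j _;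
  by rewrite sumE; apply: eq_bigr => k _; rewrite !(nuE, alE) /r restrB.
congr (_ - _); apply: eq_bigr => i _; rewrite sumE; apply: eq_bigr => j _;
  last by rewrite nuE alE.
by rewrite sumE; apply: eq_bigr => k _; rewrite !(nuE, alE).
Qed.

End Equivariant.

(* Main.v *)
Require Import Defs.
From mathcomp Require Import all_boot all_order all_algebra all_fingroup.
Import GRing.Theory.
Local Open Scope ring_scope.

(** Modulo [t^(n+2)], the axioms of a deformation say that the coefficients of
    [t^0, ..., t^(n+1)] on both sides agree.  In degree at most [n], a new top
    coefficient [(nu', al')] cannot contribute, so there the axioms are those
    of the given deformation.  In degree [n+1] they say that sums of products
    indexed by [i + j + k = n+1] (or [i + j = n+1]) cancel.  Since [n+1 > 0],
    at most one of the indices can be [n+1], and then the others are [0]: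
    such a sum is the part with all indices at most [n], plus one term for
    each position that [n+1] can take ([sum3_split], [sum2_split]).  The parts
    with indices at most [n] make up the obstruction.  In the other terms the
    remaining indices are [0], where the coefficients are the product and
    the twist of the algebra, so these terms are linear in [(nu', al')], and
    they add up to the opposite of the coboundary of [(nu', al')]
    ([coboundary_nuE], [coboundary_alE]).
    Hence the axioms in degree [n+1] read: obstruction = coboundary of
    [(nu', al')].  The equivariance axiom in degree [n+1] is literally the
    invariance of the cochain [(nu', al')], so extensions of the deformation
    are the same data as invariant 2-cochains that bound the obstruction. *)

Set Implicit Arguments.
Unset Strict Implicit.

(** * Sums over indices of fixed total degree *)

Section Splitting.

Variable V : zmodType.

Definition sum2 n m (F : 'I_n.+1 -> 'I_n.+1 -> V) : V :=
  \sum_(i < n.+1) \sum_(j < n.+1 | (i + j == m)%N) F i j.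

Definition sum3 n m (F : 'I_n.+1 -> 'I_n.+1 -> 'I_n.+1 -> V) : V :=
  \sum_(i < n.+1) \sum_(j < n.+1) \sum_(k < n.+1 | (i + j + k == m)%N) F i j k.

Lemma eq_sum2 n m (F G : 'I_n.+1 -> 'I_n.+1 -> V) :
  (forall i j, F i j = G i j) -> sum2 m F = sum2 m G.
Proof. by move=> e; do 2!apply: eq_bigr => ? _. Qed.

Lemma eq_sum3 n m (F G : 'I_n.+1 -> 'I_n.+1 -> 'I_n.+1 -> V) :
  (forall i j k, F i j k = G i j k) -> sum3 m F = sum3 m G.
Proof. by move=> e; do 3!apply: eq_bigr => ? _. Qed.

Lemma sum3B n m (F G : 'I_n.+1 -> 'I_n.+1 -> 'I_n.+1 -> V) :
  sum3 m F - sum3 m G = sum3 m (fun i j k => F i j k - G i j k).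
Proof.
by rewrite -sumrB; apply: eq_bigr => i _; rewrite -sumrB;
   apply: eq_bigr => j _; rewrite -sumrB.
Qed.

Lemma sum3_swap n m (F : 'I_n.+1 -> 'I_n.+1 -> 'I_n.+1 -> V) :
  sum3 m F = sum3 m (fun i j k => F i k j).
Proof.
apply: eq_bigr => i _; under eq_bigr do rewrite big_mkcond.
rewrite exchange_big; apply: eq_bigr => j _; rewrite [RHS]big_mkcond.
by apply: eq_bigr => k _; rewrite addnAC.
Qed.

Let sum1_recr n s m (f : 'I_n.+2 -> V) :
  \sum_(k < n.+2 | (s + k == m)%N) f k =
  \sum_(k < n.+1 | (s + k == m)%N) f (widen_ord (leqnSn n.+1) k)
  + (if (s + n.+1 == m)%N then f ord_max else 0).
Proof. by rewrite big_mkcond big_ord_recr /= -big_mkcond. Qed.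

Let addn_gtF n m s : (m <= n)%N -> (n.+1 + s == m)%N = false.
Proof.
by move=> le_mn; apply/gtn_eqF; rewrite (leq_trans _ (leq_addr _ _)).
Qed.

Let addn_eql s k : (s + k == s)%N = (k == 0)%N.
Proof. by rewrite -[X in _ == X]addn0 eqn_add2l. Qed.

Let addn_eqr s k : (k + s == s)%N = (k == 0)%N.
Proof. by rewrite addnC addn_eql. Qed.

(** The index [n+1] cannot occur in a total degree [m <= n]. *)
Lemma sum2_low n m (F : 'I_n.+2 -> 'I_n.+2 -> V) : (m <= n)%N ->
  let w := widen_ord (leqnSn n.+1) in
  sum2 m F = sum2 m (fun i j => F (w i) (w j)).
Proof.
move=> le_mn w; have gtF s := addn_gtF s le_mn.
rewrite /sum2 big_ord_recr /= [X in _ + X]big1 => [|j]; last by rewrite gtF.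
rewrite addr0; apply: eq_bigr => i _.
by rewrite sum1_recr [(_ + n.+1)%N]addnC gtF addr0.
Qed.

Lemma sum3_low n m (F : 'I_n.+2 -> 'I_n.+2 -> 'I_n.+2 -> V) : (m <= n)%N ->
  let w := widen_ord (leqnSn n.+1) in
  sum3 m F = sum3 m (fun i j k => F (w i) (w j) (w k)).
Proof.
move=> le_mn w; have gtF s := addn_gtF s le_mn.
rewrite /sum3 big_ord_recr /= [X in _ + X]big1 => [|j _]; last first.
  by apply: big1 => k; rewrite -addnA gtF.
rewrite addr0; apply: eq_bigr => i _.
rewrite big_ord_recr /= [X in _ + X]big1 => [|k]; last first.
  by rewrite -addnA addnCA gtF.
rewrite addr0; apply: eq_bigr => j _.
by rewrite sum1_recr [(_ + n.+1)%N]addnC gtF addr0.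
Qed.

(** An index equal to [n+1] leaves only [0] for the others, and since [n+1] is
    positive, no term is counted twice. *)
Lemma sum2_split n (F : 'I_n.+2 -> 'I_n.+2 -> V) :
  let w := widen_ord (leqnSn n.+1) in
  sum2 n.+1 F =
  sum2 n.+1 (fun i j => F (w i) (w j)) + F ord0 ord_max + F ord_max ord0.
Proof.
move=> w; rewrite /sum2 big_ord_recr /=; congr (_ + _); last first.
  by rewrite (big_pred1 ord0) // => j; rewrite addn_eql.
under eq_bigr do rewrite sum1_recr.
rewrite big_split /=; congr (_ + _).
rewrite -big_mkcond /= (big_pred1 ord0) => [|i].
  by congr F; apply: val_inj.
by rewrite /= addn_eqr.
Qed.

Lemma sum3_split n (F : 'I_n.+2 -> 'I_n.+2 -> 'I_n.+2 -> V) :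
  let w := widen_ord (leqnSn n.+1) in
  sum3 n.+1 F =
  sum3 n.+1 (fun i j k => F (w i) (w j) (w k))
  + F ord0 ord0 ord_max + F ord0 ord_max ord0 + F ord_max ord0 ord0.
Proof.
move=> w.
have w0 : w ord0 = ord0 by apply: val_inj.
rewrite /sum3 big_ord_recr /=; congr (_ + _); last first.
  (* The terms with [i = n+1]: the degree forces [j = k = 0]. *)
  rewrite (bigD1 ord0) //= [X in _ + X]big1 ?addr0
    => [|[[|j] lt_j] // _]; last first.
    by apply: big1 => k; rewrite /= -addnA addn_eql.
  rewrite (big_pred1 ord0) // => k.
  by rewrite addn0 addn_eql.
under eq_bigr do rewrite big_ord_recr /=.
rewrite big_split /=; congr (_ + _); last first.
  (* The terms with [j = n+1] and [i <= n]. *)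
  rewrite (bigD1 ord0) //= [X in _ + X]big1 ?addr0
    => [|[[|i] lt_i] // _]; last first.
    by apply: big1 => k; rewrite /= addnAC addn_eqr.
  by rewrite (big_pred1 ord0) -/w ?w0.
under eq_bigr do under eq_bigr do rewrite sum1_recr.
under eq_bigr do rewrite big_split /=.
rewrite big_split /=; congr (_ + _).
(* The terms with [k = n+1] and [i, j <= n]. *)
rewrite (bigD1 ord0) //= [X in _ + X]big1 ?addr0 => [|[[|i] lt_i] // _].
  by rewrite -big_mkcond /= (big_pred1 ord0) -/w ?w0 // => j; rewrite addn_eqr.
by apply: big1 => j _; rewrite /= addn_eqr.
Qed.

End Splitting.

(** * Coefficients of the two deformation equations *)

Section Coefficients.

Variables (K : fieldType) (B : homPreLieType K) (n : nat).
Variable nu : 'I_n.+1 -> {bilinear B -> B -> B}.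
Variable al : 'I_n.+1 -> {linear B -> B}.
Implicit Types (a b c : B).

(** The index of the twisting map is the third one, as in the obstruction, so
    that in degree [n+1] the antisymmetrization in [(a, b)] unfolds to the
    obstruction. *)
Definition circ_coef m a b c : B :=
  sum3 m (fun i j k => circ (nu i) (al k) (nu j) a b c).

Definition mult_coefl m a b : B := sum3 m (fun i j k => nu i (al j a) (al k b)).

Definition mult_coefr m a b : B := sum2 m (fun i j => al i (nu j a b)).

(** The ranges of the indices can be enlarged from [0, ..., m] to [0, ..., n],
    since the condition on the total degree rejects what is added.  When [f]
    and [g] are images of constant series, [linS_const] and [bilS_const] give
    their coefficients exactly over this larger range. *)
Lemma linSE m (f : nat -> B) : (m <= n)%N ->
  linS al f m = sum2 m (fun i j : 'I_n.+1 => al i (f j)).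
Proof.
move=> le_mn; apply: eq_bigr => i _.
rewrite (big_ord_widen_cond n.+1 (fun j => i + j == m)%N
  (fun j => al i (f j))) //.
apply: eq_bigl => j; case: eqP => //= <-.
by rewrite ltnS leq_addl.
Qed.

Lemma bilSE m (f g : nat -> B) : (m <= n)%N ->
  bilS nu f g m = sum3 m (fun i j k : 'I_n.+1 => nu i (f j) (g k)).
Proof.
move=> le_mn; apply: eq_bigr => i _.
under eq_bigr do rewrite (big_ord_widen_cond n.+1
  (fun k => i + _ + k == m)%N (fun k => nu i (f _) (g k))) //.
rewrite (big_ord_widen n.+1 (fun j => \sum_(k < n.+1 |
  (i + j + k == m)%N && (k < m.+1)%N) nu i (f j) (g k))) // big_mkcond.
apply: eq_bigr => j _; case: ltnP => [_|lt_mj].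
  apply: eq_bigl => k; case: eqP => //= <-.
  by rewrite ltnS leq_addl.
rewrite big_pred0 // => k; apply: gtn_eqF.
by rewrite addnAC (leq_trans lt_mj) ?leq_addl.
Qed.

(** Both products of [circ] become sums over the same triples once the last
    two indices of the second one are exchanged: there the series of twisting
    maps is in the first argument. *)
Lemma hom_pre_lie_coefE m a b c : (m <= n)%N ->
  subS (bilS nu (bilS nu (constS a) (constS b)) (linS al (constS c)))
       (bilS nu (linS al (constS a)) (bilS nu (constS b) (constS c))) m
  = circ_coef m a b c.
Proof.
move=> le_mn; rewrite /subS !bilSE // [X in _ - X]sum3_swap sum3B.
by apply: eq_sum3 => i j k; rewrite !bilS_const !linS_const.
Qed.

Lemma mult_coeflE m a b : (m <= n)%N ->
  bilS nu (linS al (constS a)) (linS al (constS b)) m = mult_coefl m a b.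
Proof.
by move=> le_mn; rewrite bilSE //; apply: eq_sum3 => *; rewrite !linS_const.
Qed.

Lemma mult_coefrE m a b : (m <= n)%N ->
  linS al (bilS nu (constS a) (constS b)) m = mult_coefr m a b.
Proof.
by move=> le_mn; rewrite linSE //; apply: eq_sum2 => *; rewrite bilS_const.
Qed.

End Coefficients.

(** * Adding a coefficient of degree n+1 *)

Lemma add_coef_max T n (f : 'I_n.+1 -> T) x : add_coef f x ord_max = x.
Proof. by rewrite /add_coef unlift_none. Qed.

Lemma add_coef_lift T n (f : 'I_n.+1 -> T) x i :
  add_coef f x (lift ord_max i) = f i.
Proof. by rewrite /add_coef liftK. Qed.

Lemma add_coef_widen T n (f : 'I_n.+1 -> T) x i :
  add_coef f x (widen_ord (leqnSn n.+1) i) = f i.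
Proof.
rewrite -[RHS](add_coef_lift f x); congr add_coef.
by apply: val_inj; rewrite /= /bump leqNgt ltn_ord.
Qed.

Lemma add_coef0 T n (f : 'I_n.+1 -> T) x : add_coef f x ord0 = f ord0.
Proof. by rewrite -(add_coef_widen f x); congr add_coef; apply: val_inj. Qed.

Lemma add_eq_subr (V : zmodType) (x y u v d : V) :
  v - u = d -> (x + u = y + v <-> x - y = d).
Proof.
move=> <-; have e : (x + u == y + v) = (x - y == v - u).
  by rewrite subr_eq addrAC [RHS]eq_sym subr_eq eq_sym addrC.
by split=> /eqP exy; apply/eqP; rewrite ?e // -e.
Qed.

Section Extension.

Variables (K : fieldType) (B : homPreLieType K) (n : nat).
Variable nu : 'I_n.+1 -> {bilinear B -> B -> B}.
Variable al : 'I_n.+1 -> {linear B -> B}.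
Variables (nu' : {bilinear B -> B -> B}) (al' : {linear B -> B}).
Implicit Types (a b c : B).

Hypothesis nu0 : forall a b, nu ord0 a b = hmul a b.
Hypothesis al0 : forall a, al ord0 a = twist a.

Let nue := add_coef nu nu'.
Let ale := add_coef al al'.

Lemma circ_coef_low m a b c : (m <= n)%N ->
  circ_coef nue ale m a b c = circ_coef nu al m a b c.
Proof.
move=> le_mn; rewrite /circ_coef sum3_low //.
by apply: eq_sum3 => i j k; rewrite /nue /ale !add_coef_widen.
Qed.

Lemma mult_coefl_low m a b : (m <= n)%N ->
  mult_coefl nue ale m a b = mult_coefl nu al m a b.
Proof.
move=> le_mn; rewrite /mult_coefl sum3_low //.
by apply: eq_sum3 => i j k; rewrite /nue /ale !add_coef_widen.
Qed.

Lemma mult_coefr_low m a b : (m <= n)%N ->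
  mult_coefr nue ale m a b = mult_coefr nu al m a b.
Proof.
move=> le_mn; rewrite /mult_coefr sum2_low //.
by apply: eq_sum2 => i j; rewrite /nue /ale !add_coef_widen.
Qed.

Lemma circ_coef_top a b c :
  circ_coef nue ale n.+1 a b c =
  circ_coef nu al n.+1 a b c
  + circ hmul al' hmul a b c + circ hmul twist nu' a b c
  + circ nu' twist hmul a b c.
Proof.
rewrite /circ_coef sum3_split /= {2 3 4}/circ /nue /ale.
rewrite !add_coef_max !add_coef0 !nu0 !al0; congr (_ + _ + _ + _).
by apply: eq_sum3 => i j k; rewrite /nue /ale !add_coef_widen.
Qed.

Lemma mult_coefl_top a b :
  mult_coefl nue ale n.+1 a b =
  mult_coefl nu al n.+1 a b
  + hmul (twist a) (al' b) + hmul (al' a) (twist b) + nu' (twist a) (twist b).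
Proof.
rewrite /mult_coefl sum3_split /= /nue /ale.
rewrite !add_coef_max !add_coef0 !nu0 !al0; congr (_ + _ + _ + _).
by apply: eq_sum3 => i j k; rewrite /nue /ale !add_coef_widen.
Qed.

Lemma mult_coefr_top a b :
  mult_coefr nue ale n.+1 a b =
  mult_coefr nu al n.+1 a b + twist (nu' a b) + al' (hmul a b).
Proof.
rewrite /mult_coefr sum2_split /= /nue /ale.
rewrite !add_coef_max !add_coef0 nu0 al0; congr (_ + _ + _).
by apply: eq_sum2 => i j; rewrite /nue /ale !add_coef_widen.
Qed.

(** The terms with an index [n+1] are [circ] with [nu'] or [al'] in one of its
    three slots, and the product or the twist in the other two.  On the right
    of the equation minus on the left, they are the eight terms of [d_nunu]
    for [nu'] and minus the four terms of [d_alnu] for [al']. *)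
Lemma coboundary_nuE a b c :
  circ_coef nue ale n.+1 a b c = circ_coef nue ale n.+1 b a c <->
  circ_coef nu al n.+1 a b c - circ_coef nu al n.+1 b a c =
  d_nunu nu' a b c - d_alnu al' a b c.
Proof.
rewrite !circ_coef_top -!addrA; apply: add_eq_subr.
rewrite /d_nunu /d_alnu /circ !opprD !opprK !addrA.
by rewrite [LHS](ACl (10*4*3*9*6*12*11*5*2*8*7*1)).
Qed.

Lemma coboundary_alE a b :
  mult_coefl nue ale n.+1 a b = mult_coefr nue ale n.+1 a b <->
  mult_coefl nu al n.+1 a b - mult_coefr nu al n.+1 a b =
  d_nual nu' a b - d_alal al' a b.
Proof.
rewrite mult_coefl_top mult_coefr_top -!addrA; apply: add_eq_subr.
rewrite /d_nual /d_alal !opprD !opprK !addrA.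
by rewrite [LHS](ACl (1*5*3*4*2)).
Qed.

End Extension.

(** * Extensions are cochains bounding the obstruction *)

Lemma eqS_modS (K : fieldType) (V : lmodType K) N (f g : nat -> V) :
  eqS_mod N f g -> f N = g N -> eqS_mod N.+1 f g.
Proof.
by move=> e eN m; rewrite ltnS leq_eqVlt => /predU1P[->|/e].
Qed.

Theorem theorem5p5 (K : fieldType) (charK : [pchar K] =i pred0)
    (A : homPreLieType K) (regA : regular A)
    (gT : finGroupType) (psi : hpl_action gT A) (n : nat)
    (nu : nu_family psi n) (al : al_family psi n)
    (defA : equivariant_deformation nu al) :
  extendable nu al <-> obstruction_class_vanishes nu al.
Proof.
case: (defA) => nu0 al0 hplP multP nu_eq al_eq.
split.
  case=> nu' [al' [_ _ hplP' multP' nu_eq' al_eq']].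
  exists (fun H => Cochain2 (nu' H) (al' H)).
    move=> H J g sHJ r; split=> [a b|a] /=.
      have := nu_eq' H J g sHJ a b n.+1 (ltnSn _).
      by rewrite /= !(bilS_const _ _ _ ord_max) !add_coef_max.
    have := al_eq' H J g sHJ a n.+1 (ltnSn _).
    by rewrite /= !(linS_const _ _ ord_max) !add_coef_max.
  move=> H; split=> [a b c|a b].
    apply/coboundary_nuE; [exact: nu0 | exact: al0 |].
    by have := hplP' H a b c n.+1 (ltnSn _); rewrite !hom_pre_lie_coefE.
  apply/coboundary_alE; [exact: nu0 | exact: al0 |].
  by have := multP' H a b n.+1 (ltnSn _); rewrite mult_coeflE // mult_coefrE.
case=> x x_inv obsE; exists (fun H => c2nu (x H)), (fun H => c2al (x H)).
split=> [H a b|H a|H a b c|H a b|H J g sHJ a b|H J g sHJ a].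
- by rewrite add_coef0 nu0.
- by rewrite add_coef0 al0.
- apply: eqS_modS => [m lt_m|].
    have le_m := ltnW lt_m; have := hplP H a b c m lt_m.
    by rewrite !hom_pre_lie_coefE // !circ_coef_low.
  rewrite !hom_pre_lie_coefE //.
  by apply/coboundary_nuE; [exact: nu0 | exact: al0 | exact: (obsE H).1].
- apply: eqS_modS => [m lt_m|].
    have le_m := ltnW lt_m; have := multP H a b m lt_m.
    rewrite !mult_coeflE // !mult_coefrE //.
    by rewrite mult_coefl_low // mult_coefr_low.
  rewrite mult_coeflE // mult_coefrE //.
  by apply/coboundary_alE; [exact: nu0 | exact: al0 | exact: (obsE H).2].
- move=> m lt_m; rewrite /= !(bilS_const _ _ _ (Ordinal lt_m)).
  case: (unliftP ord_max (Ordinal lt_m)) => [i ->|->].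
    rewrite !add_coef_lift.
    by have := nu_eq H J g sHJ a b i (ltn_ord i); rewrite /= !bilS_const.
  by rewrite !add_coef_max; apply: (x_inv H J g sHJ).1.
- move=> m lt_m; rewrite /= !(linS_const _ _ (Ordinal lt_m)).
  case: (unliftP ord_max (Ordinal lt_m)) => [i ->|->].
    rewrite !add_coef_lift.
    by have := al_eq H J g sHJ a i (ltn_ord i); rewrite /= !linS_const.
  by rewrite !add_coef_max; apply: (x_inv H J g sHJ).2.
Qed.
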